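(* Let $\mathcal U$ be a set, $R:\mathcal U\to\mathcal U$ a map with iterates $R_n$, and $k(z,w)=1+t(z,w)$ with $t(z,w)$ positive definite in $\mathcal U$. Let $(e_j)_{j\in J}$ be an orthonormal basis of $\mathcal H(k)$. Let $$\Omega=\Big\{z\in\mathcal U:\ \sum_{n=0}^\infty|t(R_n(z),R_n(z))|<\infty\Big\},$$ assume $\Omega\neq\emptyset$, and let $K(z,w)=\prod_{n=0}^\infty\big(1+t(R_n(z),R_n(w))\big)$ for $z,w\in\Omega$. Assume that $$n(z):=\mathrm{Card}\{\zeta\in\Omega:\ R(\zeta)=z\}<\infty\quad\text{for all } z\in\Omega,$$ and that at least one of the following two conditions holds: (i) for all $z\in\Omega$ and all $j,k\in J$, $\displaystyle \frac{1}{n(z)}\sum_{\zeta\in\Omega,\,R(\zeta)=z}e_j(\zeta)\overline{e_k(\zeta)}=\delta_{jk}$; (ii) for all $z\in\Omega$ and all $j,k\in J$, $\displaystyle \frac{1}{n(z)}\sum_{\zeta\in\Omega,\,R(\zeta)=z}e_j(\zeta)e_k(\zeta)=\delta_{jk}$. Then the operators $(S_jf)(z)=e_j(z)f(R(z))$, $j\in J$, on $\mathcal H(K)$ satisfy the Cuntz relations, that is, $$S_i^*S_j=\delta_{ij}I_{\mathcal H(K)}\ \ (i,j\in J),\qquad \sum_{j\in J}S_jS_j^*=I_{\mathcal H(K)}.$$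
   Context: For a complex number $c$, $c^*=\overline c$ denotes its complex conjugate. A function $t:\mathcal U\times\mathcal U\to\mathbb C$ is positive definite on $\mathcal U$ if $\sum_{p,q=1}^M c_p^*\,t(w_p,w_q)\,c_q\ge 0$ for all $M\in\mathbb N$, $w_1,\dots,w_M\in\mathcal U$, $c_1,\dots,c_M\in\mathbb C$. $\mathcal H(k)$ denotes the reproducing kernel Hilbert space of functions on $\mathcal U$ with reproducing kernel $k$; for any orthonormal basis $(e_j)_{j\in J}$ of it, $k(z,w)=\sum_{j\in J}e_j(z)e_j(w)^*$. The iterates are $R_0(z)=z$, $R_n=R\circ\cdots\circ R$ ($n$ times). One has $R(\Omega)\subset\Omega$; the infinite product defining $K$ converges on $\Omega\times\Omega$, $K$ is positive definite on $\Omega$ and $K(z,w)=k(z,w)K(R(z),R(w))$ there. $\mathcal H(K)$ is the reproducing kernel Hilbert space of functions on $\Omega$ with reproducing kernel $K$; each $S_j$ is a bounded operator from $\mathcal H(K)$ into itself. *)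

(* Defs.v *)
From HB Require Import structures.
From mathcomp Require Import all_boot all_order all_algebra finmap.
From mathcomp Require Import all_classical all_reals all_analysis.
From mathcomp Require Import complex summability.

Set Implicit Arguments.
Unset Strict Implicit.
Unset Printing Implicit Defensive.

Import Order.TTheory GRing.Theory Num.Theory.
Import numFieldNormedType.Exports.

Local Open Scope classical_set_scope.
Local Open Scope ring_scope.

(* The order of [R[i]] is partial: [0 <= x] says that x is real and
   nonnegative. *)
Definition positive_definite (R : realType) (X : Type) (t : X -> X -> R[i]) :=
  forall (M : nat) (w : 'I_M -> X) (c : 'I_M -> R[i]),
    0 <= \sum_(p < M) \sum_(q < M) (c p)^* * t (w p) (w q) * c q.

(* [inner] is linear in its first argument and conjugate-linear in the second. *)
Record hilbert (R : realType) := Hilbert {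
  hspace :> completeNormedModType R[i];
  inner : {dot hspace for Num.conj};
  inner_norm : forall f, `|f| ^+ 2 = inner f f }.

(* A Hilbert space of functions on X: [ev] is the injective linear map sending
   an element of the space to the function that it is. *)
Record rkhs (R : realType) (X : Type) (k : X -> X -> R[i]) := Rkhs {
  rkhs_space :> hilbert R;
  ev : rkhs_space -> X -> R[i];
  ev_linear : forall (a : R[i]) (f g : rkhs_space) (x : X),
    ev (a *: f + g) x = a * ev f x + ev g x;
  ev_inj : injective ev;
  ev_reproducing : forall w : X, exists kw : rkhs_space,
    (forall z, ev kw z = k z w) /\ (forall f, inner rkhs_space f kw = ev f w) }.

Definition orthonormal_basis (R : realType) (H : hilbert R) (J : choiceType)
    (e : J -> H) :=
  (forall i j, inner H (e i) (e j) = (i == j)%:R) /\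
  closure [set f : H | exists (A : {fset J}) (c : J -> R[i]),
                         f = \sum_(j <- A) c j *: e j] = setT.

Definition bounded_operator (R : realType) (H : hilbert R) (T : H -> H) :=
  linear T /\ exists M : R[i], forall f : H, `|T f| <= M * `|f|.

Definition is_adjoint (R : realType) (H : hilbert R) (T Tstar : H -> H) :=
  forall f g : H, inner H (T f) g = inner H f (Tstar g).

(* The last sum converges strongly, along the net of finite subsets of J. *)
Definition cuntz_relations (R : realType) (H : hilbert R) (J : choiceType)
    (S : J -> H -> H) :=
  exists Sstar : J -> H -> H,
    [/\ forall j, bounded_operator (Sstar j) /\ is_adjoint (S j) (Sstar j),
        forall i j f, Sstar i (S j f) = (i == j)%:R *: f
      & forall f, partial_sum (fun j => S j (Sstar j f)) @ totally --> f].

Section InfiniteProductKernel.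
Variables (R : realType) (U : choiceType) (r : U -> U) (t : U -> U -> R[i]).

Definition Omega : set U := [set z |
  (\sum_(0 <= n <oo) (Normc.normc (t (iter n r z) (iter n r z)))%:E < +oo)%E].

Lemma Omega_stable (z : U) : Omega z -> Omega (r z).
Proof.
rewrite /Omega /= => h; apply: le_lt_trans h.
have norm0 x : (0 <= (Normc.normc (x : R[i]))%:E)%E.
  by rewrite lee_fin; case: x => a b; exact: sqrtr_ge0.
rewrite [leRHS]nneseries_recl// -[X in (_ <= _ + X)%E]nneseries_addn//.
rewrite [leLHS](_ : _ = \sum_(0 <= n <oo)
  (Normc.normc (t (iter (n + 1) r z) (iter (n + 1) r z)))%:E)%E; last first.
  by apply: eq_eseriesr => n _; rewrite addn1 iterSr.
exact: leeDr.
Qed.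

Definition r_Omega (z : set_type Omega) : set_type Omega :=
  exist _ (r (val z)) (mem_set (Omega_stable (set_mem (valP z)))).

(* [R[i]] is given its norm topology through its alias [R[i]^o]. *)
Definition K_Omega (z w : set_type Omega) : R[i] :=
  lim ((fun N => \prod_(0 <= n < N)
          (1 + t (iter n r (val z)) (iter n r (val w))) : R[i]^o) @ \oo).

Definition fiber (z : U) : set U := [set zeta | Omega zeta /\ r zeta = z].

End InfiniteProductKernel.

(* Main.v *)
Require Import Defs.
From HB Require Import structures.
From mathcomp Require Import all_boot all_order all_algebra finmap.
From mathcomp Require Import all_classical all_reals all_analysis.
From mathcomp Require Import complex summability.
From mathcomp Require Import ring.

Set Implicit Arguments.
Unset Strict Implicit.
Unset Printing Implicit Defensive.

Import Order.TTheory GRing.Theory Num.Theory.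
Import numFieldNormedType.Exports.

Local Open Scope classical_set_scope.
Local Open Scope ring_scope.

(** The proof rests on two facts about the operators S_j f = e_j (f o rho),
    where rho is the restriction of r to Omega, K is the product kernel,
    k = 1 + t and K_w denotes the function K(., w).

    First, the S_j form a row contraction whose adjoints resolve the identity.
    On kernel functions the adjoint has to be
    S_j^* K_w = conj(e_j(w)) K_(rho w).  Since k(z, w) is the sum of the
    e_j(z) conj(e_j(w)) ([kernel_expansion]) and K(z, w) = k(z, w)
    K(rho z, rho w) ([K_Omega_functional]), every finite combination v of kernel
    functions satisfies the Parseval identity sum_j |S_j^* v|^2 = |v|^2
    ([parseval_cvg]).  By duality this bounds the functions
    sum_(j in A) e_j (h_j o rho): they belong to H(K), with squared norm at most
    sum_(j in A) |h_j|^2 ([row_contraction]).  A consequence for every g is the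
    defect inequality
      |g - sum_(j in A) S_j S_j^* g|^2 <= |g|^2 - sum_(j in A) |S_j^* g|^2
    ([wcomp_defect]).  Its right-hand side tends to 0 for v as above, by
    Parseval; as such v are dense and the operators on the left are
    contractions, sum_j S_j S_j^* = I strongly ([wcomp_resolution]).

    Secondly, the averages over the fibres make the coefficients of such an
    expansion unique.  Applied to g = S_j f and evaluated at a preimage x of z,
    the resolution of the identity reads
      e_j(x) f(z) = sum_l e_l(x) (S_l^* S_j f)(z).
    Averaging over the preimages of z against conj(e_i) under condition (i), or
    against e_i under condition (ii), leaves
      delta_ij f(z) = (S_i^* S_j f)(z)
    ([wcomp_orthogonal]).  Both conditions enter only as the existence, for each
    z and i, of weights on the fibre of z that are biorthogonal to the e_l.

    Adjoints, membership in H(K) and density of the kernel functions all come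
    from one form of the Riesz representation theorem, for functionals given by
    a linear relation ([riesz_relation]). *)

(** * Dot products and Hilbert spaces *)
Section DotProduct.
Variables (C : numClosedFieldType) (U : lmodType C) (dot : {dot U for Num.conj}).
Local Notation "''[' u , v ]" := (dot u v) : ring_scope.

Lemma dotC u v : '[u, v] = '[v, u]^*.
Proof. by rewrite hermC expr0 mul1r. Qed.

Lemma dotZl a u v : '[a *: u, v] = a * '[u, v].
Proof. exact: linearZl_LR. Qed.

Lemma dotZr a u v : '[u, a *: v] = a^* * '[u, v].
Proof. exact: linearZr_LR. Qed.

Lemma dot_suml I (s : seq I) (F : I -> U) v :
  '[\sum_(i <- s) F i, v] = \sum_(i <- s) '[F i, v].
Proof. exact: linear_sumlz. Qed.

Lemma dot_sumr I (s : seq I) (F : I -> U) u :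
  '[u, \sum_(i <- s) F i] = \sum_(i <- s) '[u, F i].
Proof. exact: linear_sumr. Qed.

Lemma add_conj_dot_le u v : '[u, v] + '[u, v]^* <= '[u, u] + '[v, v].
Proof. by rewrite -subr_ge0 -dnormB dnorm_ge0. Qed.

(** The Cauchy-Schwarz inequality without finite dimension: it is the positivity
    of the squared length of '[v, v] u - '[u, v] v, divided by '[v, v]. *)
Lemma sqr_dot_le u v : `|'[u, v]| ^+ 2 <= '[u, u] * '[v, v].
Proof.
have [->|v0] := eqVneq v 0; first by rewrite (linear0r _ u) normr0 expr0n mulr_ge0 ?dnorm_ge0.
have vv_gt0 : 0 < '[v, v] by rewrite dnorm_gt0.
have vvR : '[v, v]^* = '[v, v] by rewrite -dotC.
rewrite -(ler_pM2l vv_gt0) -subr_ge0.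
suff <- : '['[v, v] *: u - '[u, v] *: v, '[v, v] *: u - '[u, v] *: v] =
    '[v, v] * ('[u, u] * '[v, v]) - '[v, v] * `|'[u, v]| ^+ 2.
  exact: dnorm_ge0.
rewrite dnormB !dnormZ dotZl dotZr (normCKC '[u, v]).
have -> : `|'[v, v]| ^+ 2 = '[v, v] * '[v, v] by rewrite normCK vvR.
rewrite !rmorphM /= conjCK vvR; ring.
Qed.
End DotProduct.

Section Hilbert.
Variables (R : realType) (H : hilbert R).
Local Notation "''[' u , v ]" := (inner H u v) : ring_scope.
Implicit Types f g h : H.

Lemma cauchy_schwarz f g : `|'[f, g]| <= `|f| * `|g|.
Proof.
rewrite -(@ler_pXn2r _ 2) ?nnegrE ?mulr_ge0//.
by rewrite exprMn !inner_norm sqr_dot_le.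
Qed.

Lemma inner_le_norm_le f g : '[f, f] <= '[g, g] -> `|f| <= `|g|.
Proof. by rewrite -!inner_norm ler_pXn2r// ?nnegrE. Qed.

Lemma dist_innerl f g h : `|'[f, h] - '[g, h]| <= `|f - g| * `|h|.
Proof. by rewrite -linearBl cauchy_schwarz. Qed.

Lemma norm_lt_sqr f (x : R[i]) : 0 <= x -> '[f, f] < x ^+ 2 -> `|f| < x.
Proof. by move=> x0; rewrite -inner_norm ltr_pXn2r// ?nnegrE. Qed.

End Hilbert.

(** * The order of the complex numbers *)
Section ComplexOrder.
Variable R : realType.
Implicit Types x y : R[i].

Lemma gt0_complexE x : 0 < x -> exists2 e : R, 0 < e & x = e%:C%C.
Proof.
move=> x0; exists (complex.Re x); last by rewrite RRe_real// gtr0_real.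
by rewrite -ltcR RRe_real// gtr0_real.
Qed.

Lemma lec_addgt0P x y :
  (forall e : R, 0 < e -> x <= y + (e%:C)%C) -> x <= y.
Proof.
move=> h; rewrite lecE; apply/andP; split.
  by have := h _ ltr01; rewrite lecE => /andP[]; case: (x) (y) => ? ? [? ?]/=; rewrite addr0.
apply/ler_addgt0Pr => e e0; have := h _ e0.
by rewrite lecE => /andP[_]; case: (x) (y) => ? ? [? ?].
Qed.

Lemma eq0_small x (M : R[i]) : 0 <= M ->
  (forall e : R, 0 < e -> `|x| <= (e%:C)%C * M) -> x = 0.
Proof.
move=> M0 h; apply/eqP; rewrite -normr_le0; apply: lec_addgt0P => e e0.
have M1 : 0 < M + 1 by rewrite ltr_wpDl.
have [m m0 mE] := gt0_complexE M1.
rewrite add0r (le_trans (h (e / m) _))// ?divr_gt0//.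
rewrite (@le_trans _ _ (((e / m)%:C)%C * (M + 1)))//.
  by rewrite ler_wpM2l ?lerDl// lecR divr_ge0// ltW.
by rewrite mE -rmorphM/= divfK ?gt_eqF.
Qed.

End ComplexOrder.

(** * Riesz representation of a linear relation *)
Section Riesz.
Variables (R : realType) (H : hilbert R).
Local Notation "''[' u , v ]" := (inner H u v) : ring_scope.
Variables (G : set (H * R[i])) (N : R[i]).
Hypotheses (G0 : G (0, 0))
  (G_lin : forall a g h b c, G (g, b) -> G (h, c) -> G (a *: g + h, a * b + c))
  (G_bound : forall h c, G (h, c) -> c + c^* <= '[h, h] + N).

(** If f represents G, then energy x c = |x - f|^2 - |f|^2 on G, so f is to be
    found as the limit of minimizers of the energy; [G_bound] says that the energy
    is at least - N. *)
Let energy (x : H) (c : R[i]) : R[i] := '[x, x] - (c + c^*).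

Let energy_real x c : energy x c \is Num.real.
Proof.
by apply/CrealP; rewrite /energy rmorphB/= rmorphD/= conjCK -dotC [c^* + c]addrC.
Qed.

Let parallelogram x y a b : '[x - y, x - y] =
  2 * (energy x a + energy y b)
  - 4 * energy (2^-1 *: (x + y)) (2^-1 * a + 2^-1 * b).
Proof.
rewrite /energy dnormZ (dnormD _ x y) dnormB !rmorphD/= !rmorphM/= normCK fmorphV/= conjC_nat.
by field.
Qed.

Let variation l x h a c : energy (l *: h + x) (l * c + a) =
  energy x a + (l * ('[h, x] - c) + (l * ('[h, x] - c))^*) + `|l| ^+ 2 * '[h, h].
Proof.
rewrite /energy dnormD dnormZ dotZl !rmorphD/= !rmorphM/= rmorphB/=; ring.
Qed.

Let d : R := inf [set complex.Re (energy x.1 x.2) | x in G].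

Let G_energy_lb x c : G (x, c) -> (d%:C)%C <= energy x c.
Proof.
move=> Gx; rewrite -[leRHS]RRe_real// lecR; apply: ge_inf; last by exists (x, c).
exists (complex.Re (- N)) => _ [[y b] Gy <-] /=.
have := G_bound Gy; rewrite -subr_ge0 -[X in X - _]addrC -addrA => h.
have : - N <= energy y b by rewrite lerNl -subr_ge0 /energy opprK.
by rewrite lecE => /andP[].
Qed.

Let near_min (e : R) : set H :=
  [set x | exists2 c, G (x, c) & energy x c < ((d + e)%:C)%C].

Let near_min_neq0 e : 0 < e -> near_min e !=set0.
Proof.
move=> e0.
have [|_ [[x c] Gx <-] /= xe] := @inf_adherent _ _ e e0 _ : exists2 y, _ y & y < d + e.
  split; first by exists (complex.Re (energy 0 0)), (0, 0).
  exists d => _ [[x c] Gx <-]; rewrite -lecR [leRHS]RRe_real//.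
  exact: G_energy_lb.
by exists x, c => //; rewrite -[ltLHS]RRe_real// ltcR.
Qed.

(** Near-minimizers are close to each other: this is the parallelogram law, the
    midpoint being again in the domain of G. *)
Let near_min_close e x y : near_min e x -> near_min e y ->
  '[x - y, x - y] < ((4 * e)%:C)%C.
Proof.
move=> [a Gx xe] [b Gy ye]; rewrite (parallelogram x y a b).
have Gm : G (2^-1 *: (x + y), 2^-1 * a + 2^-1 * b).
  rewrite scalerDr; apply: G_lin => //.
  by rewrite -[_ *: y]addr0 -[_ * b]addr0; apply: G_lin.
have : ((4 * e)%:C)%C = 2 * (((d + e)%:C)%C + ((d + e)%:C)%C) - 4 * (d%:C)%C :> R[i].
  by rewrite !rmorphD/= !rmorphM/= rmorph_nat; ring.
move->; apply: ltr_leB; first by rewrite ltr_pM2l// ltrD.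
by rewrite ler_pM2l// G_energy_lb.
Qed.

(** A near-minimizer almost represents the relation, otherwise moving it along h
    would lower the energy below the infimum. *)
Let near_min_dual e x h c : near_min e x -> G (h, c) ->
  `|'[h, x] - c| ^+ 2 <= (e%:C)%C * (1 + '[h, h]).
Proof.
move=> [a Gx xe] Gh; set D := '[h, x] - c; set m := '[h, h].
have m0 : 0 <= m by exact: dnorm_ge0.
have m1 : 0 < 1 + m by rewrite ltr_wpDr.
have mR : (1 + m)^* = 1 + m by apply/CrealP; rewrite ger0_real// ltW.
(* The optimal step along h is - D^* / '[h, h]; the denominator 1 + '[h, h]
   allows h = 0. *)
have := G_energy_lb (G_lin (- (D^* / (1 + m))) Gh Gx).
rewrite variation -/D -/m normrN normf_div norm_conjC (ger0_norm (ltW m1)).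
have -> : energy x a + (- (D^* / (1 + m)) * D + (- (D^* / (1 + m)) * D)^*)
  + (`|D| / (1 + m)) ^+ 2 * m = energy x a - `|D| ^+ 2 / (1 + m)
      - (`|D| / (1 + m)) ^+ 2.
  rewrite !rmorphM/= !rmorphN/= !rmorphM/= conjCK fmorphV/= mR.
  rewrite !expr_div_n normCK; field; exact: lt0r_neq0.
move=> h1; rewrite -ler_pdivrMr//.
have : (d%:C)%C < ((d + e)%:C)%C - `|D| ^+ 2 / (1 + m).
  apply: le_lt_trans h1 _; rewrite ltrBlDr ltr_wpDr ?ltrD2r//.
  by rewrite exprn_ge0// divr_ge0// ltW.
by rewrite rmorphD/= -addrA ltrDl subr_gt0; exact: ltW.
Qed.

(** The functional is given by its graph G, so that it may live on a subspace on
    which it is only known through representations of vectors as combinations;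
    that it is single-valued is part of the conclusion.  The bound
    2 Re c <= |h|^2 + N is, by homogeneity, the bound |c| <= sqrt N |h|, but it is
    additive, so sums of such bounds need no Cauchy-Schwarz inequality. *)
Theorem riesz_relation : exists f : H, [/\ forall h c, G (h, c) -> '[h, f] = c,
  closure [set h | exists c, G (h, c)] f & '[f, f] <= N].
Proof.
pose F : set_system H := filter_from [set e : R | 0 < e] near_min.
have FF : ProperFilter F.
  apply: filter_from_proper; last exact: near_min_neq0.
  apply: filter_from_filter; first by exists 1; rewrite /= ltr01.
  move=> e1 e2 /= e10 e20; exists (Num.min e1 e2); first by rewrite /= lt_min e10.
  move=> x [c Gx xe]; split; exists c => //; apply: (lt_le_trans xe);
    by rewrite lecR lerD2l ge_min lexx ?orbT.
have : cauchy F.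
  apply: cauchy_exP => _ /gt0_complexE[e e0 ->].
  have e4 : 0 < e ^+ 2 / 4 by rewrite divr_gt0// exprn_gt0.
  have [x xe] := near_min_neq0 e4.
  exists x, (e ^+ 2 / 4) => // y ye.
  rewrite -ball_normE /=; apply: norm_lt_sqr; first by rewrite lecR ltW.
  apply: lt_le_trans (near_min_close xe ye) _.
  by rewrite mulrC divfK ?pnatr_eq0// rmorphXn.
move=> /cauchy_cvgP; set f : H := lim F => Ff.
have approx (e e' : R) : 0 < e -> 0 < e' ->
    exists2 x, near_min e' x & `|f - x| < (e%:C)%C.
  move=> e0 e'0.
  have : F (near_min e' `&` ball f (e%:C)%C).
    apply: filterI; first by exists e'.
    by apply: Ff; apply: nbhsx_ballx; rewrite ltcR.
  by move=> /filter_ex[x [xe]]; rewrite -ball_normE /=; exists x.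
have dual h c : G (h, c) -> '[h, f] = c.
  move=> Gh; apply/eqP; rewrite -subr_eq0; apply/eqP.
  apply: (@eq0_small _ _ (1 + 2 * `|h|)); first by rewrite addr_ge0// mulr_ge0.
  move=> e e0; have [||x xe fx] := approx e (e ^+ 2) => //; first by rewrite exprn_gt0.
  have -> : '[h, f] - c = '[h, f - x] + ('[h, x] - c) by rewrite linearBr/=; ring.
  rewrite (le_trans (ler_normD _ _))//.
  have -> : (e%:C)%C * (1 + 2 * `|h|) = `|h| * (e%:C)%C + (e%:C)%C * (1 + `|h|) :> R[i].
    by ring.
  have eC : 0 <= (e%:C)%C :> R[i] by rewrite lecR ltW.
  apply: lerD; first by rewrite (le_trans (cauchy_schwarz _ _))// ler_wpM2l// ltW.
  rewrite -(@ler_pXn2r _ 2) ?nnegrE ?mulr_ge0 ?addr_ge0//.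
  rewrite (le_trans (near_min_dual xe Gh))// rmorphXn/= exprMn.
  rewrite ler_wpM2l ?exprn_ge0// -inner_norm.
  rewrite sqrrD expr1n mul1r -addrA lerD2l lerDr mulrn_wge0//.
exists f; split => //.
- move=> B Bf.
  have : F (B `&` near_min 1).
    by apply: filterI; [exact: Ff|exists 1; rewrite /= ?ltr01].
  by move=> /filter_ex[x [Bx [c Gx _]]]; exists x; split => //; exists c.
- apply: lec_addgt0P => e e0.
  have [||x [c Gx _] fx] := approx (Num.sqrt e) 1; rewrite ?sqrtr_gt0//.
  have := G_bound Gx; rewrite -(dual _ _ Gx) -dotC => h.
  have : '[f - x, f - x] <= (e%:C)%C.
    rewrite -inner_norm -(sqr_sqrtr (ltW e0)) rmorphXn/= ler_pXn2r ?nnegrE//.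
      exact: ltW.
    by rewrite lecR sqrtr_ge0.
  rewrite dnormB -(dotC) => h2.
  have := lerD h h2.
  rewrite -subr_ge0 => h3; rewrite -subr_ge0; apply: le_trans h3 _.
  by rewrite le_eqVlt; apply/orP; left; apply/eqP; ring.
Qed.

End Riesz.

(** * Adjoints of contractions *)
Section Adjoint.
Variables (R : realType) (H : hilbert R) (T : H -> H).
Local Notation "''[' u , v ]" := (inner H u v) : ring_scope.
Hypotheses (T_lin : linear T) (T_contr : forall f, '[T f, T f] <= '[f, f]).

Lemma adjoint_linear (Tstar : H -> H) : is_adjoint T Tstar -> linear Tstar.
Proof.
move=> adj a g h; apply/eqP; rewrite -subr_eq0 -(dnorm_eq0 (inner H)).
set u := _ - _; rewrite {2}/u linearBr/= linearDr/= dotZr -!adj linearDr/= dotZr.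
by rewrite subrr.
Qed.

Lemma contraction_bounded : bounded_operator T.
Proof.
by split => //; exists 1 => f; rewrite mul1r; apply: inner_le_norm_le.
Qed.

Lemma contraction_adjoint : exists Tstar : H -> H,
  is_adjoint T Tstar /\ forall g, '[Tstar g, Tstar g] <= '[g, g].
Proof.
have /choice[Tstar adj] (g : H) : exists g', (forall f, '[f, g'] = '[T f, g]) /\
    '[g', g'] <= '[g, g].
  pose G := [set p : H * R[i] | p.2 = '[T p.1, g]].
  have [|||f [dual _ le]] := @riesz_relation _ H G '[g, g].
  - have T0 : T 0 = 0.
      by have := T_lin (-1) 0 0; rewrite scaler0 addr0 scaleN1r addNr.
    by rewrite /G /= T0 linear0l.
  - by move=> a f h b c; rewrite /G /= => -> ->; rewrite T_lin linearDl/= dotZl.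
  - by move=> f b; rewrite /G /= => ->; rewrite (le_trans (add_conj_dot_le _ _ _))// lerD2r.
  - by exists f; split => // h; apply: dual.
by exists Tstar; split => [f g|g]; [rewrite (adj g).1|exact: (adj g).2].
Qed.

End Adjoint.

(** * Orthonormal expansions *)
#[local] Existing Instance totally_filter.

Section OrthonormalBasis.
Variables (R : realType) (H : hilbert R) (J : choiceType) (e : J -> H).
Hypothesis e_basis : orthonormal_basis e.
Local Notation "''[' u , v ]" := (inner H u v) : ring_scope.

Let inner_comb (A : {fset J}) (c : J -> R[i]) j : j \in A ->
  '[\sum_(i <- A) c i *: e i, e j] = c j.
Proof.
move=> jA; rewrite dot_suml (big_fsetD1 j)//= dotZl e_basis.1 eqxx mulr1.
rewrite big1_seq ?addr0// => i /andP[_]; rewrite !inE => /andP[ij _].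
by rewrite dotZl e_basis.1 (negbTE ij) mulr0.
Qed.

(** Pythagoras: f - sum_j '[f, e_j] e_j is orthogonal to the span of the e_j, j in
    A.  This makes the error decrease along the net of finite sets. *)
Lemma fourier_best_approximation (f : H) (A : {fset J}) (c : J -> R[i]) :
  `|f - \sum_(j <- A) '[f, e j] *: e j| <= `|f - \sum_(j <- A) c j *: e j|.
Proof.
set p := \sum_(j <- A) '[f, e j] *: e j; set q := \sum_(j <- A) _.
apply: inner_le_norm_le.
have -> : f - q = (f - p) + (p - q) by rewrite addrA subrK.
have -> : p - q = \sum_(j <- A) ('[f, e j] - c j) *: e j.
  by rewrite /p /q -sumrB; apply: eq_bigr => j _; rewrite scalerBl.
have orth : '[f - p, \sum_(j <- A) ('[f, e j] - c j) *: e j] = 0.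
  rewrite dot_sumr big1_seq// => j /andP[_ jA].
  by rewrite dotZr linearBl/= inner_comb// subrr mulr0.
by rewrite (hnormDd orth) lerDl dnorm_ge0.
Qed.

Lemma fourier_cvg (f : H) :
  (fun A : {fset J} => \sum_(j <- A) '[f, e j] *: e j) @ totally --> f.
Proof.
apply/cvgrPdist_lt => eps eps0.
have : closure [set f : H | exists (A : {fset J}) (c : J -> R[i]),
    f = \sum_(j <- A) c j *: e j] f by rewrite e_basis.2.
move=> /(_ (ball f eps))[|_ [[A [c ->]]]]; first exact: nbhsx_ballx.
rewrite -ball_normE /= => fA; exists A => // B /= AB.
(* Extending c by 0 turns a combination over A into one over B. *)
pose c' j := if j \in A then c j else 0.
apply: le_lt_trans (fourier_best_approximation f B c') _.
suff -> : \sum_(j <- B) c' j *: e j = \sum_(j <- A) c j *: e j by [].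
rewrite (big_fsetID _ (mem A))/= [X in _ + X]big1_seq ?addr0; last first.
  by move=> j /andP[_]; rewrite !inE/= /c' => /andP[_ /negbTE->]; rewrite scale0r.
have -> : [fset x | x in B & x \in A]%fset = A.
  by apply/fsetP => j; rewrite !inE/= andbC; apply: andb_idr => /(fsubsetP AB).
by apply: eq_big_seq => j jA; rewrite /c' jA.
Qed.

End OrthonormalBasis.

Lemma cvg_innerl (R : realType) (H : hilbert R) (T : Type) (F : set_system T)
    (FF : Filter F) (u : T -> H) (f g : H) : u @ F --> f ->
  (fun x => inner H (u x) g : R[i]^o) @ F --> (inner H f g : R[i]^o).
Proof.
move=> /cvgrPdist_lt uf; apply/cvgrPdist_lt => eps eps0.
have g1 : 0 < `|g| + 1 by rewrite ltr_wpDl.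
have /uf : 0 < eps / (`|g| + 1) by rewrite divr_gt0.
apply: filterS => x; rewrite ltr_pdivlMr// => h.
apply: le_lt_trans h; apply: le_trans (dist_innerl _ _ _) _.
by rewrite ler_wpM2l// lerDl.
Qed.

(** * Reproducing kernel Hilbert spaces *)
Section ReproducingKernel.
Variables (R : realType) (X : Type) (K : X -> X -> R[i]) (H : rkhs K).
Local Notation "''[' u , v ]" := (inner H u v) : ring_scope.

Definition kerfun (w : X) : H := sval (cid (ev_reproducing H w)).

Lemma ev_kerfun z w : ev (kerfun w) z = K z w.
Proof. by rewrite /kerfun; case: cid => kw []. Qed.

Lemma inner_kerfun f w : '[f, kerfun w] = ev f w.
Proof. by rewrite /kerfun; case: cid => kw []. Qed.

(** Combinations are indexed by sequences, with repetitions allowed: sums and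
    multiples of combinations are then concatenations and rescalings. *)
Definition kercomb (s : seq (R[i] * X)) : H := \sum_(p <- s) p.1 *: kerfun p.2.

Lemma ev_sum (I : Type) (s : seq I) (F : I -> H) z :
  ev (\sum_(i <- s) F i) z = \sum_(i <- s) ev (F i) z.
Proof.
by rewrite -inner_kerfun dot_suml; apply: eq_bigr => i _; rewrite inner_kerfun.
Qed.

Lemma inner_kercombl s f : '[kercomb s, f] = \sum_(p <- s) p.1 * (ev f p.2)^*.
Proof.
by rewrite dot_suml; apply: eq_bigr => p _; rewrite dotZl dotC inner_kerfun.
Qed.

(** The functional kercomb s |-> sum_p p.1 conj(F p.2) would be the dot product
    with F; the Riesz theorem applied to it produces F itself as an element of the
    space, which moreover lies in the closed span of the kernel functions. *)
Lemma rkhs_membership (F : X -> R[i]) (N : R[i]) :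
  (forall s : seq (R[i] * X), let c := \sum_(p <- s) p.1 * (F p.2)^* in
     c + c^* <= '[kercomb s, kercomb s] + N) ->
  exists f : H, [/\ ev f =1 F, closure (range kercomb) f & '[f, f] <= N].
Proof.
move=> F_le.
pose G := [set p : H * R[i] | exists2 s, p.1 = kercomb s &
                                p.2 = \sum_(p <- s) p.1 * (F p.2)^*].
have [|||f [dual fG le]] := @riesz_relation _ H G N.
- by exists [::] => /=; rewrite /kercomb !big_nil.
- move=> a f h b c [s /= -> ->] [t /= -> ->].
  exists ([seq (a * p.1, p.2) | p <- s] ++ t); rewrite /kercomb /= big_cat big_map/=.
    by rewrite scaler_sumr; congr (_ + _); apply: eq_bigr => p _; rewrite scalerA.
  by rewrite mulr_sumr; congr (_ + _); apply: eq_bigr => p _; rewrite mulrA.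
- by move=> h c [s /= -> ->].
exists f; split => //.
  move=> w; rewrite -inner_kerfun dotC (@dual _ (F w)^*) ?conjCK//.
  by exists [:: (1, w)]; rewrite /kercomb /= big_seq1 ?scale1r ?mul1r.
move=> B /fG[_ [[c [s /= -> _]] Bs]].
by exists (kercomb s); split => //; exists s.
Qed.

(** Membership applied to ev f reconstructs f inside the closed span. *)
Lemma kercomb_dense f : closure (range kercomb) f.
Proof.
have [s|g [gf g_cl _]] := @rkhs_membership (ev f) '[f, f].
  by rewrite /= -inner_kercombl; exact: add_conj_dot_le.
by have -> : f = g by apply: ev_inj; apply/funext => z; rewrite gf.
Qed.

End ReproducingKernel.

(** The Fourier expansion of the kernel function at w, evaluated at z. *)
Lemma kernel_expansion (R : realType) (X : Type) (k : X -> X -> R[i]) (H : rkhs k)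
    (J : choiceType) (e : J -> H) : orthonormal_basis e -> forall z w,
  (fun A : {fset J} => \sum_(j <- A) ev (e j) z * (ev (e j) w)^* : R[i]^o)
    @ totally --> (k z w : R[i]^o).
Proof.
move=> e_basis z w.
have -> : (fun A : {fset J} => \sum_(j <- A) ev (e j) z * (ev (e j) w)^*) =
    (fun A : {fset J} =>
       inner H (\sum_(j <- A) inner H (kerfun H w) (e j) *: e j) (kerfun H z)).
  apply/funext => A; rewrite dot_suml; apply: eq_bigr => j _.
  by rewrite dotZl inner_kerfun dotC inner_kerfun mulrC.
rewrite -(ev_kerfun H z w) -inner_kerfun.
exact: cvg_innerl (@fourier_cvg _ _ _ _ e_basis (kerfun H w)).
Qed.

(** * Weighted composition operators *)
Lemma cvg_sum_seq (K : numFieldType) (V : normedModType K) (T I : Type)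
    (F : set_system T) (FF : Filter F) (s : seq I) (u : I -> T -> V) (l : I -> V) :
  (forall i, u i @ F --> l i) ->
  (fun x => \sum_(i <- s) u i x) @ F --> \sum_(i <- s) l i.
Proof.
move=> ul; elim: s => [|i s IH].
  rewrite big_nil [X in X @ _](_ : _ = fun=> 0); first exact: cvg_cst.
  by apply/funext => x; rewrite big_nil.
rewrite big_cons [X in X @ _](_ : _ = fun x => u i x + \sum_(i <- s) u i x).
  exact: cvgD.
by apply/funext => x; rewrite big_cons.
Qed.

Lemma dot_inj (R : realType) (H : hilbert R) (u v : H) :
  (forall f, inner H f u = inner H f v) -> u = v.
Proof.
move=> uv; apply/eqP; rewrite -subr_eq0 -(dnorm_eq0 (inner H)).
by rewrite linearBr/= uv subrr.
Qed.

Section WeightedComposition.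
Variables (R : realType) (X : Type) (K k : X -> X -> R[i]) (rho : X -> X).
Variables (H : rkhs K) (J : choiceType) (e : J -> X -> R[i]).
Hypothesis k_expansion : forall z w,
  (fun A : {fset J} => \sum_(j <- A) e j z * (e j w)^* : R[i]^o)
    @ totally --> (k z w : R[i]^o).
Hypothesis K_functional : forall z w, K z w = k z w * K (rho z) (rho w).
Local Notation "''[' u , v ]" := (inner H u v) : ring_scope.

(** The representation of S_j^* (kercomb s), see [wcomp_adjoint_kercomb]; it is
    available before S_j itself is. *)
Definition pull (j : J) (s : seq (R[i] * X)) :=
  [seq (p.1 * (e j p.2)^*, rho p.2) | p <- s].

Lemma inner_kercomb (s t : seq (R[i] * X)) : '[kercomb H s, kercomb H t] =
  \sum_(p <- s) \sum_(q <- t) p.1 * q.1^* * K q.2 p.2.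
Proof.
rewrite dot_suml; apply: eq_bigr => p _; rewrite dot_sumr; apply: eq_bigr => q _.
by rewrite dotZl dotZr inner_kerfun ev_kerfun mulrA.
Qed.

(** Expanding both sides on kernel functions reduces the statement to
    sum_j e_j(z) conj(e_j(w)) K(rho z, rho w) = k(z, w) K(rho z, rho w) = K(z, w). *)
Lemma parseval_cvg s :
  (fun A : {fset J} => \sum_(j <- A) '[kercomb H (pull j s), kercomb H (pull j s)] : R[i]^o)
    @ totally --> ('[kercomb H s, kercomb H s] : R[i]^o).
Proof.
rewrite [X in X @ _](_ : _ = fun A : {fset J} =>
    \sum_(p <- s) \sum_(q <- s) (p.1 * q.1^* * K (rho q.2) (rho p.2)) *
       \sum_(j <- A) e j q.2 * (e j p.2)^*); last first.
  apply/funext => A; under eq_bigr => j _.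
    rewrite inner_kercomb big_map; under eq_bigr => p _ do rewrite big_map/=.
    over.
  rewrite exchange_big/=; apply: eq_bigr => p _.
  rewrite exchange_big/=; apply: eq_bigr => q _.
  by rewrite mulr_sumr; apply: eq_bigr => j _; rewrite rmorphM/= conjCK; ring.
rewrite inner_kercomb; apply: (@cvg_sum_seq _ R[i]^o) => p.
apply: (@cvg_sum_seq _ R[i]^o) => q.
have -> : p.1 * q.1^* * K q.2 p.2 =
    p.1 * q.1^* * K (rho q.2) (rho p.2) * k q.2 p.2 by rewrite K_functional; ring.
exact: (@cvgZl_tmp _ R[i]^o _ _ _ _ _ _ (@k_expansion q.2 p.2)).
Qed.

(** The partial sums are bounded by their limit since they increase. *)
Lemma parseval_le (A : {fset J}) s :
  \sum_(j <- A) '[kercomb H (pull j s), kercomb H (pull j s)] <= '[kercomb H s, kercomb H s].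
Proof.
apply: lec_addgt0P => eps eps0.
have /cvgrPdist_lt/(_ (eps%:C)%C) := @parseval_cvg s.
rewrite ltcR => /(_ eps0)[B _ Bh].
have /Bh /= : (B `<=` A `|` B)%fset by rewrite fsubsetUr.
set sA := \sum_(j <- A) _; set sAB := \sum_(j <- _) _; set v := '[_, _] => lt_eps.
have sum_real (D : {fset J}) :
    0 <= \sum_(j <- D) '[kercomb H (pull j s), kercomb H (pull j s)].
  by apply: sumr_ge0 => j _; exact: dnorm_ge0.
have : sA <= sAB.
  rewrite /sAB (big_fsetID _ (mem A))/=.
  have -> : [fset x | x in (A `|` B)%fset & x \in A]%fset = A.
    by apply/fsetP => j; rewrite !inE/=; case: (j \in A); rewrite ?andbF ?orbT.
  by rewrite lerDl; exact: sum_real.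
move=> /le_trans; apply; rewrite -lerBlDl; apply: le_trans (ltW lt_eps).
rewrite distrC real_ler_norm// rpredB ?ger0_real ?dnorm_ge0//; exact: sum_real.
Qed.

(** This is the dual form of [parseval_le]: the functional attached to the function
    maps kercomb s to sum_j '[kercomb (pull j s), h j], and 2 Re '[u, h] is at most
    |u|^2 + |h|^2. *)
Lemma row_contraction (A : {fset J}) (h : J -> H) : exists f : H,
  (forall z, ev f z = \sum_(j <- A) e j z * ev (h j) (rho z)) /\
  '[f, f] <= \sum_(j <- A) '[h j, h j].
Proof.
have [s|f [fE _ f_le]] := @rkhs_membership _ _ _ H
    (fun z => \sum_(j <- A) e j z * ev (h j) (rho z)) (\sum_(j <- A) '[h j, h j]);
  last by exists f.
rewrite /=; have -> : \sum_(p <- s) p.1 * (\sum_(j <- A) e j p.2 * ev (h j) (rho p.2))^*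
    = \sum_(j <- A) '[kercomb H (pull j s), h j].
  under [RHS]eq_bigr => j _ do rewrite inner_kercombl big_map/=.
  rewrite exchange_big/=; apply: eq_bigr => p _.
  rewrite rmorph_sum mulr_sumr; apply: eq_bigr => j _.
  by rewrite rmorphM/= mulrA.
rewrite rmorph_sum -big_split/=.
apply: le_trans (lerD (parseval_le A s) (lexx _)).
by rewrite -big_split/=; apply: ler_sum => j _; exact: add_conj_dot_le.
Qed.

Lemma weighted_composition_exists : exists S : J -> H -> H,
  forall j f z, ev (S j f) z = e j z * ev f (rho z).
Proof.
have /choice[S SE] (p : J * H) : exists g : H,
    forall z, ev g z = e p.1 z * ev p.2 (rho z).
  have [g [gE _]] := row_contraction [fset p.1]%fset (fun=> p.2).
  by exists g => z; rewrite gE big_seq_fset1.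
by exists (fun j f => S (j, f)) => j f; exact: (SE (j, f)).
Qed.

Variable S : J -> H -> H.
Hypothesis S_ev : forall j f z, ev (S j f) z = e j z * ev f (rho z).

Lemma wcomp_row_contraction (A : {fset J}) (h : J -> H) :
  '[\sum_(j <- A) S j (h j), \sum_(j <- A) S j (h j)] <= \sum_(j <- A) '[h j, h j].
Proof.
have [f [fE f_le]] := row_contraction A h.
have -> // : \sum_(j <- A) S j (h j) = f.
apply: ev_inj; apply/funext => z; rewrite fE ev_sum.
by apply: eq_bigr => j _; rewrite S_ev.
Qed.

Lemma wcomp_contraction j f : '[S j f, S j f] <= '[f, f].
Proof.
by have := wcomp_row_contraction [fset j]%fset (fun=> f); rewrite !big_seq_fset1.
Qed.

Lemma wcomp_linear j : linear (S j).
Proof.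
move=> a f g; apply: ev_inj; apply/funext => z.
by rewrite ev_linear !S_ev ev_linear; ring.
Qed.

Variable Sstar : J -> H -> H.
Hypothesis S_adj : forall j, is_adjoint (S j) (Sstar j).

Lemma wcomp_adjoint_kercomb j s : Sstar j (kercomb H s) = kercomb H (pull j s).
Proof.
apply: dot_inj => f; rewrite -S_adj.
rewrite dotC [RHS]dotC !inner_kercombl big_map; congr (_^*).
by apply: eq_bigr => p _; rewrite S_ev rmorphM/= mulrA.
Qed.

(** Expand the square: with B = sum_(j in A) S_j S_j^*, both '[g, B g] and its
    conjugate are sum_(j in A) |S_j^* g|^2, which is also an upper bound of
    |B g|^2 by the row contraction inequality. *)
Lemma wcomp_defect (A : {fset J}) g :
  '[g - \sum_(j <- A) S j (Sstar j g), g - \sum_(j <- A) S j (Sstar j g)]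
    <= '[g, g] - \sum_(j <- A) '[Sstar j g, Sstar j g].
Proof.
have gS : '[g, \sum_(j <- A) S j (Sstar j g)] = \sum_(j <- A) '[Sstar j g, Sstar j g].
  by rewrite dotC dot_suml rmorph_sum; apply: eq_bigr => j _; rewrite S_adj; exact/esym/dotC.
have sR : (\sum_(j <- A) '[Sstar j g, Sstar j g])^* = \sum_(j <- A) '[Sstar j g, Sstar j g].
  by rewrite rmorph_sum; apply: eq_bigr => j _; exact/esym/dotC.
have := wcomp_row_contraction A (Sstar ^~ g).
rewrite dnormB /= gS sR; set y := '[_, _]; set x := '[g, g]; set sg := \sum_(j <- A) _.
rewrite -subr_ge0 => h; rewrite -subr_ge0.
by have -> : x - sg - (x + y - (sg + sg)) = sg - y by ring.
Qed.

(** By the defect inequality D = I - sum_(j in A) S_j S_j^* is a contraction that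
    tends to 0 on combinations of kernel functions, which are dense. *)
Lemma wcomp_resolution g :
  (fun A : {fset J} => \sum_(j <- A) S j (Sstar j g)) @ totally --> g.
Proof.
apply/cvgrPdist_lt => _ /gt0_complexE[eps eps0 ->].
have eps2 : 0 < ((eps / 2)%:C)%C :> R[i] by rewrite ltcR divr_gt0.
have [|_ [[s _ <-]]] := @kercomb_dense _ _ _ H g (ball g ((eps / 2)%:C)%C).
  exact: nbhsx_ballx.
rewrite -ball_normE /=; set v := kercomb H s => gv.
have /cvgrPdist_lt/(_ _ (exprn_gt0 2 eps2)) := @parseval_cvg s.
apply: filterS => A /=; under eq_bigr => j _ do rewrite -wcomp_adjoint_kercomb.
rewrite -/v => vA.
pose D f := f - \sum_(j <- A) S j (Sstar j f).
have D_add f h : D (f + h) = D f + D h.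
  rewrite /D [RHS]addrACA -opprD -big_split/=; congr (_ - _).
  apply: eq_bigr => j _.
  have lS := wcomp_linear j; have lSs := adjoint_linear (@S_adj j).
  have := lSs 1 f h; rewrite !scale1r => ->.
  by have := lS 1 (Sstar j f) (Sstar j h); rewrite !scale1r => ->.
have D_le f : `|D f| <= `|f|.
  apply: inner_le_norm_le; apply: le_trans (wcomp_defect A f) _.
  by rewrite lerBlDl lerDr sumr_ge0// => j _; exact: dnorm_ge0.
rewrite -/(D g) -[g](subrK v) D_add.
apply: le_lt_trans (ler_normD _ _) _.
have -> : (eps%:C)%C = ((eps / 2)%:C)%C + ((eps / 2)%:C)%C :> R[i].
  by rewrite -rmorphD -splitr.
apply: ltrD; first exact: le_lt_trans (D_le _) gv.
apply: norm_lt_sqr; first exact: ltW.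
apply: le_lt_trans vA; apply: le_trans (wcomp_defect A v) _.
rewrite real_ler_norm// rpredB ?ger0_real ?dnorm_ge0//.
by apply: sumr_ge0 => j _; exact: dnorm_ge0.
Qed.

(** Weights on the fibre of z that are biorthogonal to the functions e_l. *)
Hypothesis fiber_dual : forall (z : X) (j : J),
  exists (I : finType) (a : I -> R[i]) (zeta : I -> X),
    (forall n, rho (zeta n) = z) /\
    (forall l, \sum_n a n * e l (zeta n) = (l == j)%:R).

Lemma wcomp_pointwise_resolution g x :
  (fun A : {fset J} => \sum_(j <- A) e j x * ev (Sstar j g) (rho x) : R[i]^o)
    @ totally --> (ev g x : R[i]^o).
Proof.
have -> : (fun A : {fset J} => \sum_(j <- A) e j x * ev (Sstar j g) (rho x)) =
    (fun A : {fset J} => '[\sum_(j <- A) S j (Sstar j g), kerfun H x]).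
  apply/funext => A; rewrite dot_suml; apply: eq_bigr => j _.
  by rewrite inner_kerfun S_ev.
rewrite -inner_kerfun; exact: cvg_innerl (@wcomp_resolution g).
Qed.

(** In the pointwise resolution of S j f, the factor (Sstar l (S j f))(z) is the
    same at all points of the fibre of z, so the weights biorthogonal to the e_l
    isolate the term of index i. *)
Lemma wcomp_orthogonal i j f : Sstar i (S j f) = (i == j)%:R *: f.
Proof.
apply: ev_inj; apply/funext => z.
have -> : ev ((i == j)%:R *: f) z = (j == i)%:R * ev f z.
  by rewrite -!inner_kerfun dotZl eq_sym.
have [I [a [zeta [zetaE aE]]]] := fiber_dual z i.
rewrite -(aE j) mulr_suml.
pose u (n : I) (A : {fset J}) : R[i]^o :=
  a n * \sum_(l <- A) e l (zeta n) * ev (Sstar l (S j f)) z.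
have u_cvg n : u n @ totally --> (a n * e j (zeta n) * ev f z : R[i]^o).
  have h := @wcomp_pointwise_resolution (S j f) (zeta n).
  rewrite S_ev zetaE in h; rewrite -mulrA.
  exact: (@cvgZl_tmp _ R[i]^o _ _ _ _ _ _ h).
have sum_cvg : (fun A => \sum_n u n A) @ totally -->
    (\sum_n a n * e j (zeta n) * ev f z : R[i]^o) by exact: cvg_sum_seq u_cvg.
suff sum_cst : (fun A => \sum_n u n A) @ totally --> (ev (Sstar i (S j f)) z : R[i]^o).
  exact: (cvg_unique (@norm_hausdorff _ R[i]^o) sum_cst sum_cvg).
(* As soon as i belongs to A, the weighted sum is the i-th coefficient. *)
apply: cvg_near_cst; exists [fset i]%fset => // A /=; rewrite fsub1set => iA.
rewrite /u; under eq_bigr => n _ do rewrite mulr_sumr.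
rewrite exchange_big/= (big_fsetD1 i)//=.
under eq_bigr => n _ do rewrite mulrA.
rewrite -mulr_suml aE eqxx mul1r big1_seq ?addr0// => l /andP[_].
rewrite !inE => /andP[li _]; under eq_bigr => n _ do rewrite mulrA.
by rewrite -mulr_suml aE (negbTE li) mul0r.
Qed.

End WeightedComposition.

(** * The functional equation of the product kernel *)
Section FunctionalEquation.
Variables (R : realType).

(** No convergence is assumed: if u diverges and c != 0 then c u diverges too, and
    both sides are the default value 0 of a limit. *)
Lemma lim_scale (c : R[i]) (u : nat -> R[i]^o) :
  lim ((fun n => c * u n : R[i]^o) @ \oo) = c * lim (u @ \oo).
Proof.
have [cu|ncu] := pselect (cvg (u @ \oo)).
  exact: (cvg_lim (@norm_hausdorff _ R[i]^o) (@cvgZl_tmp _ R[i]^o _ _ _ _ _ _ cu)).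
rewrite [in RHS]dvgP// mulr0.
have [->|c0] := eqVneq c 0.
  rewrite [X in lim (X @ _)](_ : _ = fun=> 0); last by apply/funext => n; rewrite mul0r.
  exact: (cvg_lim (@norm_hausdorff _ R[i]^o) (cvg_cst _)).
have ncvg_cu : ~ cvg ((fun n => c * u n : R[i]^o) @ \oo).
  move=> cvg_cu; apply: ncu.
  have := @cvgZl_tmp _ R[i]^o _ _ _ c^-1 _ _ cvg_cu.
  have -> : (c^-1 \*: (fun n => c * u n : R[i]^o)) = u.
    by apply/funext => n /=; rewrite /GRing.scale/= mulKf.
  by move=> h; apply/cvg_ex; eexists; exact: h.
exact: dvgP ncvg_cu.
Qed.

Lemma lim_shiftS (u : nat -> R[i]^o) :
  lim ((fun n => u n.+1) @ \oo) = lim (u @ \oo).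
Proof.
rewrite /lim /lim_in; congr (get _); apply/funext => l; exact: cvg_shiftS.
Qed.

(** The partial product of length N + 1 at (z, w) is 1 + t(z, w) times the partial
    product of length N at (r z, r w). *)
Lemma K_Omega_functional (U : choiceType) (r : U -> U) (t : U -> U -> R[i])
    (z w : set_type (Omega r t)) :
  K_Omega z w = (1 + t (val z) (val w)) * K_Omega (r_Omega z) (r_Omega w).
Proof.
rewrite /K_Omega -lim_scale.
rewrite -[LHS]lim_shiftS; apply: (congr1 (fun u : nat -> R[i]^o => lim (u @ \oo))).
apply/funext => N.
rewrite big_nat_recl//=; congr (_ * _).
by apply: eq_bigr => n _; rewrite -!iterS !iterSr.
Qed.

End FunctionalEquation.

(** * The Cuntz relations *)
Theorem theorem5p4 (R : realType) (U : choiceType) (r : U -> U)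
    (t : U -> U -> R[i]) (t_pd : positive_definite t)
    (Hk : rkhs (fun z w => 1 + t z w))
    (J : choiceType) (e : J -> Hk) (e_basis : orthonormal_basis e)
    (Omega_neq0 : Omega r t !=set0)
    (HK : rkhs (@K_Omega R U r t))
    (fiber_finite : forall z, Omega r t z -> finite_set (fiber r t z))
    (fiber_mean :
      (forall z, Omega r t z -> forall j l : J,
        (#|` fset_set (fiber r t z)|%:R)^-1 *
          \sum_(zeta \in fiber r t z) ev (e j) zeta * (ev (e l) zeta)^*
        = (j == l)%:R) \/
      (forall z, Omega r t z -> forall j l : J,
        (#|` fset_set (fiber r t z)|%:R)^-1 *
          \sum_(zeta \in fiber r t z) ev (e j) zeta * ev (e l) zeta
        = (j == l)%:R)) :
  exists S : J -> HK -> HK,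
    [/\ forall j, bounded_operator (S j),
        forall j f z,
          ev (S j f) z = ev (e j) (val z) * ev f (r_Omega z)
      & cuntz_relations S].
Proof.
pose k (z w : set_type (Omega r t)) := 1 + t (val z) (val w).
pose e' j (z : set_type (Omega r t)) := ev (e j) (val z).
have k_expansion z w : (fun A : {fset J} => \sum_(j <- A) e' j z * (e' j w)^* : R[i]^o)
    @ totally --> (k z w : R[i]^o) by exact: (kernel_expansion e_basis).
have K_functional := @K_Omega_functional R U r t.
have fiber_dual (z : set_type (Omega r t)) (j : J) :
  exists (I : finType) (a : I -> R[i]) (zeta : I -> set_type (Omega r t)),
    (forall n, r_Omega (zeta n) = z) /\
    (forall l, \sum_n a n * e' l (zeta n) = (l == j)%:R).
  have zO : Omega r t (val z) by exact: set_mem (valP z).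
  have fib (n : fset_set (fiber r t (val z))) : fiber r t (val z) (val n).
    by have := valP n; rewrite in_fset_set ?inE//; exact: fiber_finite.
  have [b bE] : exists b : U -> R[i], forall l,
      (#|` fset_set (fiber r t (val z))|%:R)^-1 *
        \sum_(zeta \in fiber r t (val z)) ev (e l) zeta * b zeta = (l == j)%:R.
    case: fiber_mean => mean; [exists (fun x => (ev (e j) x)^*)|exists (ev (e j))];
      by move=> l; exact: mean.
  exists (fset_set (fiber r t (val z))).
  exists (fun n => (#|` fset_set (fiber r t (val z))|%:R)^-1 * b (val n)).
  exists (fun n => exist _ (val n) (mem_set (fib n).1)).
  split=> [n|l]; first by apply: val_inj; exact: (fib n).2.
  under eq_bigr => n _ do rewrite -mulrA [b _ * _]mulrC.
  rewrite -mulr_sumr.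
  rewrite -(big_seq_fsetE _ _ xpredT (fun x => ev (e l) x * b x))/=.
  by rewrite -fsbig_finite ?bE//; exact: fiber_finite.
have [S S_ev] := weighted_composition_exists HK k_expansion K_functional.
have S_lin := wcomp_linear S_ev.
have S_contr := wcomp_contraction k_expansion K_functional S_ev.
have /choice[Sstar Sstar_adj] j := contraction_adjoint (S_lin j) (S_contr j).
have S_adj j := (Sstar_adj j).1.
exists S; split => //.
  by move=> j; exact: contraction_bounded (S_lin j) (S_contr j).
exists Sstar; split.
- move=> j; split; last exact: S_adj.
  exact: contraction_bounded (adjoint_linear (S_adj j)) (Sstar_adj j).2.
- move=> i j f; exact: (wcomp_orthogonal k_expansion K_functional S_ev S_adj fiber_dual).
- move=> f.
  have -> : partial_sum (fun j => S j (Sstar j f)) =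
      (fun A : {fset J} => \sum_(j <- A) S j (Sstar j f)).
    apply/funext => A; rewrite /partial_sum.
    by rewrite -(big_seq_fsetE _ _ xpredT (fun j => S j (Sstar j f))).
  exact: (@wcomp_resolution _ _ _ _ _ _ _ _ k_expansion K_functional _ S_ev _ S_adj f).
Qed.
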